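(* Let $\mathscr{U}_n$ denote the set of all $n\times n$ complex unitary matrices. For fixed $U\in\mathscr{U}_n$ we have $$\mathfrak{O}_c(U)=\{V\overline{U}V^*: V\in\mathscr{U}_n \text{ and } V^t=V\}.$$
   Context: A conjugation on a complex Hilbert space is an antilinear, isometric map $C$ with $C^2=I$. For a unitary operator $U$ on a complex Hilbert space $\mathcal{H}$, the conjugate orbit is $\mathfrak{O}_c(U)=\{CUC: C \text{ a conjugation on } \mathcal{H}\}$. Unitary matrices are viewed as unitary operators on $\mathbb{C}^n$ (column vectors) by $\mathbf{x}\mapsto U\mathbf{x}$. $\overline{U}$ is the matrix $U$ with every entry complex conjugated, $V^t$ the transpose of $V$, and $V^*$ the conjugate transpose. *)

(* Defs.v *)
From HB Require Import structures.
From mathcomp Require Import all_boot all_order all_algebra.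
From mathcomp Require Import complex.
From mathcomp Require Import boolp classical_sets reals.

Set Implicit Arguments.
Unset Strict Implicit.
Unset Printing Implicit Defensive.

Import Order.TTheory GRing.Theory Num.Theory Num.Def.
Local Open Scope ring_scope.
Local Open Scope sesquilinear_scope.
Local Open Scope classical_set_scope.

Section Conjugations.
Variables (K : numClosedFieldType) (H : lmodType K) (ip : {dot H for conjC}).

Definition ip_norm (x : H) : K := sqrtC (ip x x).

Definition antilinear (f : H -> H) : Prop :=
  GRing.linear_for (conjC \; *:%R) f.

Definition isometric (f : H -> H) : Prop :=
  forall x, ip_norm (f x) = ip_norm x.

Definition conjugation (C : H -> H) : Prop :=
  [/\ antilinear C, isometric C & involutive C].

Definition conj_orbit (U : H -> H) : set (H -> H) :=
  [set C \o U \o C | C in conjugation].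

End Conjugations.

Section ColumnVectors.
Variables (K : numClosedFieldType) (n : nat).

(* [dotmx] is only defined on row vectors. *)
Definition cdot (x y : 'cV[K]_n) : K := dotmx x^T y^T.

Lemma cdotE (x y : 'cV[K]_n) : cdot x y = \sum_i x i 0 * (y i 0)^*.
Proof. by rewrite /cdot dotmxE mxE; apply: eq_bigr => i _; rewrite !mxE. Qed.

Fact cdot_is_bilinear :
  bilinear_for *%R (conjC \; *%R) (cdot : 'cV[K]_n -> 'cV[K]_n -> K).
Proof.
split=> [y a x x'|x a y y']; rewrite !cdotE /= mulr_sumr -big_split /=;
  apply: eq_bigr => i _; rewrite !mxE.
  by rewrite mulrDl mulrA.
by rewrite rmorphD rmorphM mulrDr mulrCA.
Qed.

HB.instance Definition _ :=
  bilinear_isBilinear.Build K 'cV[K]_n 'cV[K]_n K *%R (conjC \; *%R) cdot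
    cdot_is_bilinear.

Fact cdot_hermitian (x y : 'cV[K]_n) :
  cdot x y = (-1) ^+ false * (cdot y x)^*.
Proof.
rewrite mul1r !cdotE rmorph_sum; apply: eq_bigr => i _ /=.
by rewrite rmorphM /= conjCK mulrC.
Qed.

HB.instance Definition _ :=
  isHermitianSesquilinear.Build K 'cV[K]_n false conjC cdot cdot_hermitian.

Fact cdot_gt0 (x : 'cV[K]_n) : x != 0 -> 0 < cdot x x.
Proof. by move=> x0; apply: dotmx_is_dotmx; rewrite trmx_eq0. Qed.

HB.instance Definition _ := isDotProduct.Build K 'cV[K]_n cdot cdot_gt0.

Definition mxop (A : 'M[K]_n) : 'cV[K]_n -> 'cV[K]_n := fun x => A *m x.

End ColumnVectors.

(* Main.v *)
Require Import Defs.
From mathcomp Require Import all_boot all_order all_algebra.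
From mathcomp Require Import complex.
From mathcomp Require Import boolp classical_sets reals.
Import Order.TTheory GRing.Theory Num.Theory Num.Def.
Local Open Scope ring_scope.
Local Open Scope sesquilinear_scope.
Local Open Scope classical_set_scope.

(** The conjugations on C^n are exactly the maps x |-> V (conj x) with V unitary
    and symmetric: composing a conjugation with entrywise conjugation gives a
    linear isometry V, and C^2 = I reads V (conj V) = I, so that conj V = V^*
    and V is symmetric. For such a C one computes C U C = V (conj U) (conj V)
    and conj V = V^*. *)

Section ConjugationsOnColumns.
Context {K : numClosedFieldType} {n : nat}.
Implicit Types (A B V : 'M[K]_n) (x y : 'cV[K]_n).

Lemma cdot_delta x j : cdot x (delta_mx j 0) = x j 0.
Proof.
rewrite cdotE (bigD1 j) //= mxE !eqxx conjC1 mulr1 big1 ?addr0 // => i ij.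
by rewrite mxE (negPf ij) conjC0 mulr0.
Qed.

Lemma cdot_map_conj x : cdot (map_mx conjC x) (map_mx conjC x) = cdot x x.
Proof.
by rewrite !cdotE; apply: eq_bigr => i _; rewrite !mxE conjCK mulrC.
Qed.

Lemma cdot_mxE x y : cdot x y = (x^T *m map_mx conjC y) 0 0.
Proof. by rewrite /cdot dotmxE trmxK. Qed.

Lemma cdot_mul A x y : cdot (A *m x) y = cdot x (A ^t* *m y).
Proof. by rewrite !cdot_mxE trmx_mul map_mxM /= map_mxCK mulmxA. Qed.

(** [ip_norm] is a square root whose square is [cdot x x]; the root-free form is the one that later
    arguments use. *)
Lemma isometricP (f : 'cV[K]_n -> 'cV[K]_n) :
  isometric (@cdot K n) f <-> forall x, cdot (f x) (f x) = cdot x x.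
Proof.
split=> fI x; last by rewrite /ip_norm /= fI.
by move: (fI x) => /(congr1 (fun z => z ^+ 2)); rewrite !sqrtCK.
Qed.

(* Polarization with the vectors x + y and x + 'i y. *)
Lemma quadratic_form_eq0 B : (forall x, cdot (B *m x) x = 0) -> B = 0.
Proof.
move=> B0.
have polar x y : cdot (B *m x) y + cdot (B *m y) x = 0.
  move: (B0 (x + y)).
  by rewrite mulmxDr linearDr !linearDl /= !B0 add0r addr0 addrC.
have Bxy x y : cdot (B *m x) y = 0.
  (* The scalar leaves the second slot of [cdot] as [- 'i] but the first as ['i], so the two terms
     of [polar x y] are equal; their sum is then twice either one. *)
  have := polar x ('i *: y).
  rewrite -scalemxAr linearZr_LR linearZl_LR /= conjCi mulNr addrC.
  rewrite -mulrBr => /eqP; rewrite mulf_eq0 (negPf (neq0Ci _)) /= subr_eq0.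
  move=> /eqP yx; have /eqP := polar x y.
  by rewrite yx -mulr2n mulrn_eq0 /= => /eqP.
apply/matrixP=> i j; rewrite [RHS]mxE -(Bxy (delta_mx j 0) (delta_mx i 0)).
by rewrite cdot_delta -colE mxE.
Qed.

(** The quadratic form of [V ^t* *m V - 1] vanishes exactly when [V] preserves [cdot x x]. Since
    [unitarymx] means [V *m V ^t* = 1], the proof passes to [V ^t*], which puts the product in the
    other order. *)
Lemma isometric_unitary V :
  (forall x, cdot (V *m x) (V *m x) = cdot x x) <-> V \is unitarymx.
Proof.
rewrite -trmxC_unitary; split=> [VI|/unitarymxP VV x]; last first.
  by rewrite cdot_mul mulmxA -[in X in _ *m X *m _](trmxCK V) VV mul1mx.
apply/unitarymxP/eqP; rewrite trmxCK -subr_eq0.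
apply/eqP/quadratic_form_eq0 => x.
by rewrite mulmxBl mul1mx linearBl /= -mulmxA cdot_mul trmxCK VI subrr.
Qed.

(** Precomposing [C] with entrywise conjugation gives a linear map [L]; the columns of the matrix
    are the images under [L] of the standard basis. *)
Lemma antilinear_mxP (C : 'cV[K]_n -> 'cV[K]_n) :
  antilinear C -> exists V, C = fun x => V *m map_mx conjC x.
Proof.
move=> Clin; pose L x := C (map_mx conjC x).
exists (\matrix_(i, j) L (delta_mx j 0) i 0); apply/funext => x.
(* Base case for [Csum]: antilinearity with scalar [-1] gives [C 0 = - C 0 + C 0]. *)
have C0 : C 0 = 0.
  have := Clin (-1) 0 0; rewrite scaler0 addr0 /= rmorphN1 scaleN1r => C0.
  by rewrite C0 addrC subrr.
have Csum (I : finType) (a : I -> K) (v : I -> 'cV[K]_n) :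
    C (\sum_i a i *: v i) = \sum_i (a i)^* *: C (v i).
  elim/big_rec2: _ => [|i y z _ <-] //; exact: Clin.
have -> : C x = \sum_j (x j 0)^* *: L (delta_mx j 0).
  rewrite [in LHS](matrix_sum_delta x) (eq_bigr (fun j => x j 0 *: delta_mx j 0)).
    rewrite Csum; apply: eq_bigr => j _; congr (_ *: C _).
    by rewrite map_delta_mx.
  by move=> j _; rewrite big_ord1.
apply/matrixP=> i j; rewrite summxE mxE ord1; apply: eq_bigr => k _.
by rewrite !mxE mulrC.
Qed.

Lemma conjugation_mxP (C : 'cV[K]_n -> 'cV[K]_n) :
  conjugation (@cdot K n) C <->
  exists2 V, V \is unitarymx /\ V^T = V & C = fun x => V *m map_mx conjC x.
Proof.
split=> [[/antilinear_mxP [V ->] /isometricP CI CK]|[V [Vu Vs] ->]].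
  have Vu : V \is unitarymx.
    apply/isometric_unitary => x.
    by have := CI (map_mx conjC x); rewrite map_mxCK cdot_map_conj.
  exists V => //; split=> //.
  (* Column by column, by applying [C] twice to each basis vector. *)
  have VV : V *m map_mx conjC V = 1%:M.
    apply/matrixP=> i j; have := CK (delta_mx j 0).
    rewrite map_mxM map_mxCK mulmxA -colE => /matrixP/(_ i 0).
    by rewrite !mxE eqxx andbT.
  have /unitarymxP VVt := Vu.
  (* After conjugating both sides, the claim is that [V ^t*] equals the conjugate of [V]: both are
     inverses of [V]. *)
  rewrite -[LHS]map_mxCK -[RHS]map_mxCK; congr (map_mx _ _).
  by rewrite -[RHS]mul1mx -(mulmx1C VVt) -mulmxA VV mulmx1.
split.
- by move=> a x y; rewrite map_mxD map_mxZ mulmxDr -scalemxAr.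
- by apply/isometricP => x; have /isometric_unitary -> := Vu; rewrite cdot_map_conj.
(* Writing the conjugated factor as [V^T] turns the product into [V *m V ^t*]. *)
- move=> x; rewrite map_mxM map_mxCK mulmxA -{2}Vs.
  by have /unitarymxP -> := Vu; rewrite mul1mx.
Qed.

End ConjugationsOnColumns.

Theorem proposition3p4 (R : realType) (n : nat) (U : 'M[R[i]]_n)
    (hU : U \is unitarymx) :
  conj_orbit (@cdot R[i] n) (mxop U) =
  [set mxop (V *m map_mx conjC U *m V ^t*) |
     V in [set V : 'M[R[i]]_n | V \is unitarymx /\ V^T = V]].
Proof.
have orbitE V : V^T = V ->
    (fun x => V *m map_mx conjC x) \o mxop U \o (fun x => V *m map_mx conjC x) =
    mxop (V *m map_mx conjC U *m V ^t*).
  move=> Vs; apply/funext => x.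
  by rewrite /mxop /= Vs !map_mxM map_mxCK !mulmxA.
apply/seteqP; split=> T [].
- move=> C /conjugation_mxP [V [Vu Vs] ->] <-.
  by exists V => //; rewrite orbitE.
- move=> V [Vu Vs] <-; exists (fun x => V *m map_mx conjC x); last exact: orbitE.
  by apply/conjugation_mxP; exists V.
Qed.
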